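(* For each positive integer $n$, let $r(n)$ denote the number of cops needed to win the $1$-dimensional game of Rugby, played on $\mathbb{Z}\times[n]$ against a robber of speed $2$. Then $r(n)=O(n^{0.999})$; that is, there exist a constant $C_0>0$ and an integer $n_0$ such that $r(n)\le C_0\,n^{0.999}$ for all $n\ge n_0$.
   Context: Here $[n]=\{1,\dots,n\}$ and distance on $\mathbb{Z}\times[n]$ is the $l_\infty$ distance. The $1$-dimensional game of Rugby is a perfect information game on $\mathbb{Z}\times[n]$ between a finite team of cops and one robber (several cops may share a vertex). The cops first choose their initial positions. The robber then starts at $(-C,n)$, where $C$ is a very large integer, large enough that the robber's first coordinate is at least $2n$ less than the first coordinate of every cop. The two sides then move alternately forever, the cops going first: on the cops' turn each cop moves to a vertex at distance at most $1$ (possibly staying put), and on the robber's turn he moves to a vertex at distance at most $2$ (possibly staying put). The robber wins if, for every positive integer $k$, he at some time passes the line $\{k\}\times[n]$ (i.e. his first coordinate exceeds $k$), without any cop ever being at the same vertex as him; otherwise the cops win. The number of cops needed to win is the minimum $m$ such that $m$ cops can choose initial positions and have a strategy preventing the robber from winning, for every admissible $C$. *)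

(* Defs.v *)
From HB Require Import structures.
From mathcomp Require Import all_boot all_order all_algebra.
From mathcomp Require Import boolp.
From mathcomp Require Import zify.

Set Implicit Arguments.
Unset Strict Implicit.
Unset Printing Implicit Defensive.
Import Order.TTheory GRing.Theory Num.Theory.
Local Open Scope ring_scope.

(* The board Z x [n]; the row j in [n] = {1, ..., n} is the ordinal j - 1. *)
Definition vertex (n : nat) : Type := (int * 'I_n)%type.

Definition dist (n : nat) (u v : vertex n) : nat :=
  maxn `|u.1 - v.1|%N `|(u.2 : nat)%:Z - (v.2 : nat)%:Z|%N.

Definition config (m n : nat) : Type := 'I_m -> vertex n.

(* Positions of the cops and of the robber after a full round. *)
Definition state (m n : nat) : Type := (config m n * vertex n)%type.

(* Histories are listed in chronological order. *)
Definition strategy (m n : nat) : Type := seq (state m n) -> config m n.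

Definition legal_strategy (m n : nat) (sigma : strategy m n) : Prop :=
  forall (h : seq (state m n)) (s : state m n) (i : 'I_m),
    (dist (s.1 i) (sigma (rcons h s) i) <= 1)%N.

(* play t is the state after t rounds; in round t.+1 the cops first move to
   (play t.+1).1, then the robber moves to (play t.+1).2. Plays go on after
   a capture, which is recorded by caught below. *)
Definition follows (m n : nat) (sigma : strategy m n)
    (play : nat -> state m n) : Prop :=
  forall t : nat, (play t.+1).1 = sigma (mkseq play t.+1).

Definition legal_robber (m n : nat) (play : nat -> state m n) : Prop :=
  forall t : nat, (dist (play t).2 (play t.+1).2 <= 2)%N.

Definition starts_at (m n : nat) (c0 : config m n) (C : int)
    (play : nat -> state m n) : Prop :=
  [/\ (play 0%N).1 = c0, (play 0%N).2.1 = - C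
    & ((play 0%N).2.2 : nat).+1 = n].

(* The two disjuncts: a meeting at the end of a round, and one just after the
   cops' half of a round. *)
Definition caught (m n : nat) (play : nat -> state m n) : Prop :=
  exists (t : nat) (i : 'I_m),
    (play t).1 i = (play t).2 \/ (play t.+1).1 i = (play t).2.

Definition robber_wins (m n : nat) (play : nat -> state m n) : Prop :=
  (forall k : nat, (0 < k)%N -> exists t : nat, k%:Z < (play t).2.1)
  /\ ~ caught play.

Definition admissible (m n : nat) (c0 : config m n) (C : int) : Prop :=
  forall i : 'I_m, - C + (2 * n)%N%:Z <= (c0 i).1.

Definition cops_win (n m : nat) : Prop :=
  exists c0 : config m n, forall C : int, admissible c0 C ->
    exists2 sigma : strategy m n, legal_strategy sigma &
      forall play : nat -> state m n,
        starts_at c0 C play -> follows sigma play -> legal_robber play ->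
        ~ robber_wins play.

(* Two full columns of motionless cops cannot be jumped over. *)
Lemma cops_win_double (n : nat) : cops_win n (n + n).
Proof.
pose c0 : config (n + n) n := fun i =>
  match fintype.split i with inl j => (0, j) | inr j => (1, j) end.
exists c0 => C adm.
exists (fun h => last c0 (map fst h)).
  by move=> h s i; rewrite map_rcons last_rcons /dist !subrr.
move=> play [p0 x0 y0] fol leg [far free].
have stay t : (play t).1 = c0.
  elim: t => [//|t IH].
  by rewrite fol /mkseq map_comp -addn1 iotaD !map_cat /= last_cat /= add0n IH.
have left t : (play t).2.1 < 0.
  elim: t => [|t IH].
    have := adm (lshift n (play 0%N).2.2).
    rewrite /c0 -/(unsplit (inl _)) unsplitK x0 /= => h.
    have n_gt0 : (0 < n)%N by rewrite -y0.
    by lia.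
  rewrite ltNge; apply/negP => ge0.
  have := leg t; rewrite /dist geq_max => /andP[le2 _].
  have hit (i : 'I_(n + n)) : c0 i = (play t.+1).2 -> False.
    by move=> e; apply: free; exists t.+1, i; left; rewrite stay.
  have [e|e] : (play t.+1).2.1 = 0 \/ (play t.+1).2.1 = 1 by lia.
  - apply: (hit (lshift n (play t.+1).2.2)).
    rewrite /c0 -/(unsplit (inl _)) unsplitK -e.
    by case: (play t.+1).2.
  - apply: (hit (rshift n (play t.+1).2.2)).
    rewrite /c0 -/(unsplit (inr _)) unsplitK -e.
    by case: (play t.+1).2.
have [t ht] := far 1%N isT.
by have := lt_trans ht (left t).
Qed.

Lemma ex_cops_win (n : nat) : exists m : nat, `[< cops_win n m >].
Proof. by exists (n + n)%N; apply/asboolP; exact: cops_win_double. Qed.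

Definition rugby_number (n : nat) : nat := ex_minn (ex_cops_win n).

(* Main.v *)
Require Import Defs.
From mathcomp Require Import all_boot all_order all_algebra.
From mathcomp Require Import reals exp.
From mathcomp Require Import boolp zify.
Set Implicit Arguments.
Unset Strict Implicit.
Unset Printing Implicit Defensive.
Import Order.TTheory GRing.Theory Num.Theory.
Local Open Scope ring_scope.

(** The cops defend a fixed finite set of cells, a barrier that separates the
left of the strip from the right, by colouring its cells and assigning one cop
to each colour. The cop of a colour has to stand on a cell p of that colour
whenever the robber threatens p, that is, can step on p in one move. This is
possible as soon as the colouring respects pace: whenever the robber, avoiding
the barrier, can go in T moves from a place where he threatens p to a place
where he threatens another cell q of the same colour, the cop can go from p to
q in T moves. Indeed the coordinates of the cop are then partial functions of
the place of the robber, 1-Lipschitz for the time that the robber needs, and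
the usual formula, the minimum over the cells z of coord z + T with T the time
needed to threaten z, extends them to all places of the robber ([guide_hit],
[guide_le]). So the number of cops needed is at most the number of colours,
plus one for a technical reason ([cops_win_guarded]).

In the coordinates (u, v) = (x + y, x - y) the distance of the board is half of
the l1 distance, so the robber runs l1 length 4 per move and a cop 2. A barrier
is a thickened segment of the axis v = 0, from which shorter barriers stick
out. Take 201 copies of a barrier of length l, placed end to end along the
axis, and cross the row in its middle by a column of 57 transposed copies. The
column is a detour for the robber: to go along the row from one side of it to
the other he must go round the tip of an arm of the column. Hence two copies
of the row on different sides of the column, and not too far away, may be
coloured in the same way, copy i like copy i - 43 for 40 values of i. Going
from one arm of the column to the other, or from one side of the row to the
other, takes a detour round an end of the row, which is so long that 27 copies
in the upper arm may be coloured like copies in the lower arm. The column costs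
57 copies, the identifications save 40 + 27 of them: the result, of length
201 l, has 191 times as many colours as the barrier of length l
([guarded_cross]). That the saving exceeds the cost is due to the l1 distance,
for which no diagonal shortcut leads to the tip of an arm: for each side of the
row, an arm of length a saves nearly 2 a copies of the row, and the two arms
share their colours.

After k steps the length is 8 * 201 ^ k and there are 81 * 191 ^ k colours.
Since 191 <= 201 ^ 0.999, this gives O(n ^ 0.999) cops. *)

(** * Detours round a cross *)

(** A place of the plane in the coordinates (x + y, x - y), in which walls run
parallel to the axes. Pairs of different parity, which are no places of the
board, are harmless and allowed. *)
Definition point : Type := (int * int)%type.

Definition l1 (p q : point) : int := `|p.1 - q.1| + `|p.2 - q.2|.

Definition run (free : point -> Prop) (T : nat) (w : nat -> point) : Prop :=
  (forall t, (t <= T)%N -> free (w t)) /\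
  (forall t, (t < T)%N -> l1 (w t) (w t.+1) <= 4).

(** All lower bounds on the time of the robber come from a potential that is
Lipschitz along his moves; it may jump across a barrier. *)
Lemma run_potential (free : point -> Prop) (f : point -> int) (T : nat)
    (w : nat -> point) :
  (forall p q, free p -> free q -> l1 p q <= 4 -> `|f p - f q| <= 4) ->
  run free T w -> `|f (w 0%N) - f (w T)| <= 4 * T%:Z.
Proof.
move=> lip; elim: T => [|T IH] [wfree wstep]; first by lia.
have IHT : `|f (w 0%N) - f (w T)| <= 4 * T%:Z.
  by apply: IH; split=> t ht; [apply: wfree | apply: wstep]; lia.
have := lip _ _ (wfree T (leqnSn T)) (wfree T.+1 (leqnn _)) (wstep T (ltnSn T)).
lia.
Qed.

(** The walls have half-width 2, hence consist of 5 consecutive lines, and a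
move of l1 length 4 cannot jump over them. *)
Definition off_cross (h a : int) (p : point) : Prop :=
  ~ (`|p.1| <= h /\ `|p.2| <= 2) /\ ~ (`|p.2| <= a /\ `|p.1| <= 2).

(** Above the row, up to sign, the l1 distance from the tip (0, a) of the upper
arm, except that a place above the tip counts only for its excess of |u| over
the height above the tip, so that the sign may change there. The truncation at
h - 4 makes the formulas above and below the row agree near the ends of the
row, where the robber can pass from one side to the other. *)
Definition arm_potential (h a : int) (p : point) : int :=
  if 0 < p.2 then
    let e := Num.max 0 (Num.min (h - 4) (`|p.1| + a - p.2)) in
    if 0 < p.1 then e else - e
  else Num.max (4 - h) (Num.min (h - 4) p.1).

Lemma arm_potential_lip (h a : int) (p q : point) : 4 <= a -> 4 < h ->
  off_cross h a p -> off_cross h a q -> l1 p q <= 4 ->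
  `|arm_potential h a p - arm_potential h a q| <= 4.
Proof.
case: p q => [u v] [u' v']; rewrite /off_cross /arm_potential /l1 /=.
move=> ha hh [hp1 hp2] [hq1 hq2] pq.
case: (ltP 0 v) => hv; case: (ltP 0 v') => hv'.
- (* Only the upper arm can lie between two places above the row. *)
  clear hp1 hq1; case: (ltP 0 u) => hu; case: (ltP 0 u') => hu'.
  + clear hp2 hq2; lia.
  + lia.
  + lia.
  + clear hp2 hq2; lia.
- (* A move between the two sides of the row takes place near its ends. *)
  have hu : h - 4 < `|u| by clear hp2 hq2; lia.
  have hu2 : h - 4 < `|u'| by clear hp2 hq2; lia.
  clear hp1 hp2 hq1 hq2; case: ifPn => ?; lia.
- have hu : h - 4 < `|u| by clear hp2 hq2; lia.
  have hu2 : h - 4 < `|u'| by clear hp2 hq2; lia.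
  clear hp1 hp2 hq1 hq2; case: ifPn => ?; lia.
- clear hp1 hp2 hq1 hq2; lia.
Qed.

(** The horizontal distance from the nearer end of the row, with opposite signs
above and below the row; it vanishes beyond the ends, where the robber can
change sides. *)
Definition end_potential (h : int) (p : point) : int :=
  let e := Num.max 0 (h - `|p.1|) in if 0 < p.2 then e else - e.

Lemma end_potential_lip (h a : int) (p q : point) :
  off_cross h a p -> off_cross h a q -> l1 p q <= 4 ->
  `|end_potential h p - end_potential h q| <= 4.
Proof.
case: p q => [u v] [u' v']; rewrite /off_cross /end_potential /l1 /=.
move=> [hp1 hp2] [hq1 hq2] pq.
by do ![case: ifPn => ?]; lia.
Qed.

Lemma end_detour (h a : int) (T : nat) (w : nat -> point) :
  run (off_cross h a) T w ->
  `|(w 0%N).1| <= h -> `|(w T).1| <= h ->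
  (0 < (w 0%N).2) != (0 < (w T).2) ->
  2 * h - `|(w 0%N).1| - `|(w T).1| <= 4 * T%:Z.
Proof.
move=> /(run_potential (@end_potential_lip h a)); rewrite /end_potential.
by case: ifPn => h0; case: ifPn => hT //=; lia.
Qed.

(** The robber has to go round the tip of the arm on his side of the row; the
condition on h makes the way round an end of the row at least as long. *)
Lemma arm_detour (h a : int) (T : nat) (w : nat -> point) :
  4 <= a -> run (off_cross h a) T w ->
  `|(w 0%N).1| + a <= h - 4 -> `|(w T).1| + a <= h - 4 ->
  (0 < (w 0%N).1) != (0 < (w T).1) ->
  (0 < (w 0%N).2) = (0 < (w T).2) ->
  `|(w 0%N).1| + `|(w T).1| + 2 * a - `|(w 0%N).2| - `|(w T).2| <= 4 * T%:Z.
Proof.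
move=> a4.
wlog up : w / 0 < (w 0%N).2 => [above|] wrun h0 hT hside hlevel.
  case: (boolP (0 < (w 0%N).2)) => [up|down]; first exact: above.
  pose mirror (p : point) : point := (p.1, - p.2).
  have [wfree wstep] := wrun.
  have off0 := wfree 0%N isT; have offT := wfree T (leqnn _).
  rewrite -(normrN (w 0%N).2) -(normrN (w T).2).
  apply: (above (mirror \o w)) => //=.
  - by move: off0 => -[n0 _]; clear - a4 h0 n0 down; lia.
  - split=> t ht /=.
      by have := wfree t ht; rewrite /off_cross /= normrN.
    by have := wstep t ht; rewrite /l1 /=; lia.
  - by move: off0 offT => -[n0 _] [nT _]; lia.
have hh : 4 < h by lia.
have := run_potential (fun p q => @arm_potential_lip h a p q a4 hh) wrun.
rewrite /arm_potential -hlevel up.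
have upT : 0 < (w T).2 by rewrite -hlevel.
move: hside; case: ifPn => u0; case: ifPn => uT //= _; lia.
Qed.

(** * The recursive barrier *)

(** [B c] is the set of the cells of colour c of a barrier of length l centred
at the origin. The field [guarded_pace] is what allows one cop to look after all
the cells of a colour: the robber threatens p from [w 0] and q from [w T], and
meanwhile the cop has to go from p to q. *)
Record guarded_segment (l : int) (C : finType) (B : C -> point -> Prop) :
    Prop := GuardedSegment {
  guarded_extent : forall c p, B c p -> `|p.1| <= l /\ `|p.2| <= l;
  guarded_axis : forall p : point, 2 * `|p.1| <= l -> `|p.2| <= 2 ->
    exists c, B c p;
  guarded_pace : forall c p q (T : nat) w, B c p -> B c q ->
    run (fun r => forall c', ~ B c' r) T w ->
    l1 p (w 0%N) <= 4 -> l1 q (w T) <= 4 -> l1 p q <= 2 * T%:Z }.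

Definition block (c : 'I_9 * 'I_9) (p : point) : Prop :=
  p = ((c.1 : nat)%:Z - 4, (c.2 : nat)%:Z - 4).

Lemma guarded_block : guarded_segment 8 block.
Proof.
split.
- by move=> [[i hi] [j hj]] p -> /=; lia.
- move=> [u v] /= hu hv.
  have hi : (`|(u + 4)%R| < 9)%N by lia.
  have hj : (`|(v + 4)%R| < 9)%N by lia.
  exists (Ordinal hi, Ordinal hj); rewrite /block /=; congr (_, _); lia.
- by move=> c p q T w -> -> _ _ _; rewrite /l1; lia.
Qed.

(** The copies of the row are numbered from -100 to 100; copy i - 43 gets the
label of copy i for i from 2 to 41. The copies -1, 0 and 1 are left alone in
order to keep the places near copies with equal labels on different sides of
the column. *)
Definition row_label (i : int) : int :=
  if i < -41 then 60 - i else if i < -1 then i + 43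
  else if i == -1 then 101 else i.

(** The copies of the column are numbered from -28 to 28; copy j - 30 gets the
label of copy j for j from 2 to 28. *)
Definition column_label (j : int) : int :=
  if j < -1 then j + 30 else if j == -1 then 29 else j.

Definition cross (l : int) (C : finType) (B : C -> point -> Prop)
    (c : ('I_161 + 'I_30) * C) (p : point) : Prop :=
  match c.1 with
  | inl e => exists i : int, [/\ `|i| <= 100, row_label i = (e : nat)%:Z
                                & B c.2 (p.1 - i * l, p.2)]
  | inr e => exists j : int, [/\ `|j| <= 28, column_label j = (e : nat)%:Z
                                & B c.2 (p.2 - j * l, p.1)]
  end.

(** Consecutive copies of the segment leave no gap. *)
Lemma nearest_multiple (l u : int) (N : nat) :
  2 * `|u| <= (2 * N%:Z + 1) * l ->
  exists2 i : int, `|i| <= N%:Z & 2 * `|u - i * l| <= l.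
Proof.
elim: N => [|N IH] hu; first by exists 0; lia.
have [/IH[i iN il]|far] := lerP (2 * `|u|) ((2 * N%:Z + 1) * l).
  by exists i => //; lia.
have [u0|u0] := lerP 0 u; [exists N.+1%:Z | exists (- N.+1%:Z)]; lia.
Qed.

Section Cross.

Variables (l : int) (C : finType) (B : C -> point -> Prop).
Hypotheses (l8 : 8 <= l) (guardB : guarded_segment l B).

Let free (r : point) : Prop := forall c, ~ cross l B c r.

Lemma row_cover (i u v : int) (c : C) :
  `|i| <= 100 -> B c (u - i * l, v) -> exists c', cross l B c' (u, v).
Proof.
move=> hi Bc.
have he : (`|row_label i| < 161)%N.
  by rewrite /row_label; do ![case: ifPn => ?]; lia.
exists (inl (Ordinal he), c), i; split=> //=.
by rewrite /row_label; do ![case: ifPn => ?]; lia.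
Qed.

Lemma column_cover (j u v : int) (c : C) :
  `|j| <= 28 -> B c (v - j * l, u) -> exists c', cross l B c' (u, v).
Proof.
move=> hj Bc.
have he : (`|column_label j| < 30)%N.
  by rewrite /column_label; do ![case: ifPn => ?]; lia.
exists (inr (Ordinal he), c), j; split=> //=.
by rewrite /column_label; do ![case: ifPn => ?]; lia.
Qed.

Lemma cross_axis (u v : int) : 2 * `|u| <= 201 * l -> `|v| <= 2 ->
  exists c, cross l B c (u, v).
Proof.
move=> hu hv.
have [i hi hiu] : exists2 i : int, `|i| <= 100%N%:Z & 2 * `|u - i * l| <= l.
  by apply: nearest_multiple; lia.
have [c Bc] := @guarded_axis _ _ _ guardB (u - i * l, v) hiu hv.
by apply: row_cover Bc; lia.
Qed.

Lemma cross_arm (u v : int) : 2 * `|v| <= 57 * l -> `|u| <= 2 ->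
  exists c, cross l B c (u, v).
Proof.
move=> hv hu.
have [j hj hjv] : exists2 j : int, `|j| <= 28%N%:Z & 2 * `|v - j * l| <= l.
  by apply: nearest_multiple; lia.
have [c Bc] := @guarded_axis _ _ _ guardB (v - j * l, u) hjv hu.
by apply: column_cover Bc; lia.
Qed.

Lemma free_off_cross (p : point) : free p -> off_cross (100 * l) (28 * l) p.
Proof.
case: p => u v pfree; split=> -[/= h1 h2].
- have [|c] := @cross_axis u v _ h2; [lia | exact: pfree].
- have [|c] := @cross_arm u v _ h2; [lia | exact: pfree].
Qed.

Lemma run_off_cross (T : nat) (w : nat -> point) :
  run free T w -> run (off_cross (100 * l) (28 * l)) T w.
Proof. by move=> [wfree wstep]; split=> // t /wfree /free_off_cross. Qed.

Lemma near_unit (X : int) (p r : point) :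
  `|p.1 - X| <= l -> `|p.2| <= l -> l1 p r <= 4 ->
  `|r.1 - X| <= l + 4 /\ `|r.1 - X| + `|r.2| <= 2 * l + 4.
Proof. by rewrite /l1 => p1 p2 near; split; lia. Qed.

(** The cells p and q are at distance at most 47 l, for which the cop needs at
most 47 l / 2 moves, so it is enough that the robber covers 94 l. If he stays
on one side of the row, he covers horizontally at least (43 - 2) l, and
vertically twice 28 l up to the tip of an arm, reduced by 2 l because he need
not start and end on the axis; this makes 95 l - 8, where 8 accounts for the
two cells being threatened from nearby. Otherwise he has to go round an end of
the row. *)
Lemma row_pace (i : int) (c : C) (p q : point) (T : nat) (w : nat -> point) :
  2 <= i <= 41 -> B c (p.1 - i * l, p.2) -> B c (q.1 - (i - 43) * l, q.2) ->
  run free T w ->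
  (l1 p (w 0%N) <= 4 /\ l1 q (w T) <= 4) \/
  (l1 q (w 0%N) <= 4 /\ l1 p (w T) <= 4) -> l1 p q <= 2 * T%:Z.
Proof.
move=> hi /(guarded_extent guardB)[/= p1 p2] /(guarded_extent guardB)[/= q1 q2].
move=> /run_off_cross wrun near.
have il1 : 2 * l <= i * l by rewrite ler_pM2r; lia.
have il2 : i * l <= 41 * l by rewrite ler_pM2r; lia.
have e : (i - 43) * l = i * l - 43 * l by rewrite mulrBl.
rewrite e in q1 => {e}.
have pq : l1 p q <= 47 * l.
  by rewrite /l1; move: (i * l) il1 il2 p1 q1 => X; clear near; lia.
have detour : 94 * l <= 4 * T%:Z; last by lia.
have [side|side] := eqVneq (0 < (w 0%N).2) (0 < (w T).2).
- suff [u0 uT sides gain] : [/\ `|(w 0%N).1| <= 42 * l + 4,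
      `|(w T).1| <= 42 * l + 4, (0 < (w 0%N).1) != (0 < (w T).1)
      & 39 * l - 8 <= `|(w 0%N).1| + `|(w T).1| - `|(w 0%N).2| - `|(w T).2|].
    by apply: le_trans _ (arm_detour _ wrun _ _ sides side); lia.
  move: (i * l) il1 il2 p1 q1 => X X2 X41 p1 q1; clear side wrun pq.
  case: near => -[/near_unit near0 /near_unit nearT].
  + have [a0 b0] := near0 _ p1 p2; have [aT bT] := nearT _ q1 q2.
    by clear p1 p2 q1 q2 near0 nearT; split; lia.
  + have [a0 b0] := near0 _ q1 q2; have [aT bT] := nearT _ p1 p2.
    by clear p1 p2 q1 q2 near0 nearT; split; lia.
- suff [u0 uT] : `|(w 0%N).1| <= 42 * l + 4 /\ `|(w T).1| <= 42 * l + 4.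
    by apply: le_trans _ (end_detour wrun _ _ side); lia.
  move: (i * l) il1 il2 p1 q1 => X X2 X41 p1 q1; clear side wrun pq.
  case: near => -[/near_unit near0 /near_unit nearT].
  + have [a0 _] := near0 _ p1 p2; have [aT _] := nearT _ q1 q2.
    by clear p1 p2 q1 q2 near0 nearT; split; lia.
  + have [a0 _] := near0 _ q1 q2; have [aT _] := nearT _ p1 p2.
    by clear p1 p2 q1 q2 near0 nearT; split; lia.
Qed.

(** The two copies are in different arms, so the robber has to go round an end
of the row, at distance about 100 l, while the cop only goes 34 l. *)
Lemma column_pace (j : int) (c : C) (p q : point) (T : nat)
    (w : nat -> point) :
  2 <= j <= 28 -> B c (p.2 - j * l, p.1) -> B c (q.2 - (j - 30) * l, q.1) ->
  run free T w ->
  (l1 p (w 0%N) <= 4 /\ l1 q (w T) <= 4) \/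
  (l1 q (w 0%N) <= 4 /\ l1 p (w T) <= 4) -> l1 p q <= 2 * T%:Z.
Proof.
move=> hj /(guarded_extent guardB)[/= p1 p2] /(guarded_extent guardB)[/= q1 q2].
move=> /run_off_cross wrun near.
have jl1 : 2 * l <= j * l by rewrite ler_pM2r; lia.
have jl2 : j * l <= 28 * l by rewrite ler_pM2r; lia.
have e : (j - 30) * l = j * l - 30 * l by rewrite mulrBl.
rewrite e in q1 => {e}.
move: (j * l) jl1 jl2 p1 q1 => X X2 X28 p1 q1.
have pq : l1 p q <= 34 * l by rewrite /l1; clear near; lia.
have [u0 uT sides] : [/\ `|(w 0%N).1| <= l + 4,
    `|(w T).1| <= l + 4 & (0 < (w 0%N).2) != (0 < (w T).2)].
  clear wrun pq; rewrite /l1 in near.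
  by case: near => -[near0 nearT]; split; lia.
have detour : 68 * l <= 4 * T%:Z; last by lia.
by apply: le_trans _ (end_detour wrun _ _ sides); lia.
Qed.

(** Inside one copy of the barrier, the other copies only slow down the robber.
The map g is the change of coordinates to that copy. *)
Lemma unit_pace (g : point -> point) (c : C) (p q : point) (T : nat)
    (w : nat -> point) :
  (forall r r', l1 (g r) (g r') = l1 r r') ->
  (forall c' r, B c' (g r) -> exists c'', cross l B c'' r) ->
  B c (g p) -> B c (g q) -> run free T w ->
  l1 p (w 0%N) <= 4 -> l1 q (w T) <= 4 -> l1 p q <= 2 * T%:Z.
Proof.
move=> giso gcross Bp Bq [wfree wstep] near0 nearT; rewrite -giso.
apply: (guarded_pace guardB Bp Bq (w := g \o w)); rewrite /= ?giso //.
split=> t ht /=; last by rewrite giso wstep.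
by move=> c' /gcross[c'']; exact: wfree.
Qed.

(** The labels are 201 - 40 = 161 for the row and 57 - 27 = 30 for the
column. *)
Lemma guarded_cross : guarded_segment (201 * l) (cross l B).
Proof.
split.
- move=> [[e|e] c] [u v] [i [hi _ /(guarded_extent guardB)[/= h1 h2]]].
  + have : `|i * l| <= 100 * l.
      by rewrite normrM (ger0_norm (x := l)) ?ler_pM2r; lia.
    by move: (i * l) h1 => X; lia.
  + have : `|i * l| <= 28 * l.
      by rewrite normrM (ger0_norm (x := l)) ?ler_pM2r; lia.
    by move: (i * l) h1 => X; lia.
- by move=> [u v]; exact: cross_axis.
- move=> [[e|e] c] p q T w [i [hi ie Bp]] [i' [hi' ie' Bq]] wrun near0 nearT.
  + have : i' = i \/ (2 <= i <= 41 /\ i' = i - 43) \/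
        (2 <= i' <= 41 /\ i = i' - 43).
      move: ie' ie => <-; rewrite /row_label; clear - hi hi'.
      by do ![case: ifPn => ?] => ?; lia.
    case=> [ei|[[hp ei]|[hp ei]]].
    * rewrite ei in Bq.
      apply: (unit_pace (g := fun r => (r.1 - i * l, r.2))) Bp Bq wrun near0
        nearT.
        by move=> r r'; rewrite /l1 /=; congr (`|_| + _); lia.
      by move=> c' [u v]; exact: row_cover.
    * by rewrite ei in Bq; apply: row_pace hp Bp Bq wrun _; left.
    * rewrite ei in Bp.
      have -> : l1 p q = l1 q p by rewrite /l1 distrC (distrC p.2).
      by apply: row_pace hp Bq Bp wrun _; right.
  + have : i' = i \/ (2 <= i <= 28 /\ i' = i - 30) \/
        (2 <= i' <= 28 /\ i = i' - 30).
      move: ie' ie => <-; rewrite /column_label; clear - hi hi'.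
      by do ![case: ifPn => ?] => ?; lia.
    case=> [ei|[[hp ei]|[hp ei]]].
    * rewrite ei in Bq.
      apply: (unit_pace (g := fun r => (r.2 - i * l, r.1))) Bp Bq wrun near0
        nearT.
        by move=> r r'; rewrite /l1 /= addrC; congr (_ + `|_|); lia.
      by move=> c' [u v]; exact: column_cover.
    * by rewrite ei in Bq; apply: column_pace hp Bp Bq wrun _; left.
    * rewrite ei in Bp.
      have -> : l1 p q = l1 q p by rewrite /l1 distrC (distrC p.2).
      by apply: column_pace hp Bq Bp wrun _; right.
Qed.

End Cross.

Lemma guarded_segment_exists (k : nat) :
  exists (C : finType) (B : C -> point -> Prop),
    #|C| = (81 * 191 ^ k)%N /\ guarded_segment (8 * 201 ^+ k) B.
Proof.
elim: k => [|k [C [B [cardC guardB]]]].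
  exists ('I_9 * 'I_9)%type, block; rewrite card_prod !card_ord.
  by rewrite expr0 mulr1; split=> //; exact: guarded_block.
exists (('I_161 + 'I_30) * C)%type, (cross (8 * 201 ^+ k) B); split.
  rewrite card_prod card_sum !card_ord cardC expnS mulnCA //.
rewrite exprS mulrCA; apply: guarded_cross guardB.
by rewrite ler_peMr // exprn_ege1.
Qed.

(** * From a barrier to a strategy *)

Definition diagonal (z : int * int) : point := (z.1 + z.2, z.1 - z.2).

Definition spot (n : nat) (v : vertex n) : point :=
  diagonal (v.1, (v.2 : nat)%:Z).

Lemma l1_spot (n : nat) (u v : vertex n) :
  l1 (spot u) (spot v) = 2 * (dist u v)%:Z.
Proof. by rewrite /l1 /dist /=; lia. Qed.

Section Guide.

Variables (l : int) (C : finType) (B : C -> point -> Prop).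
Variable coord : int * int -> int.

Let free (r : point) : Prop := forall c, ~ B c r.

Definition reach (T : nat) (s r : point) : Prop :=
  exists w, [/\ run free T w, w 0%N = r & l1 s (w T) <= 4].

Lemma reachS (T : nat) (s r r' : point) :
  free r' -> l1 r' r <= 4 -> reach T s r -> reach T.+1 s r'.
Proof.
move=> fr' near [w [[wfree wstep] w0 wT]].
exists (fun t => if t is t'.+1 then w t' else r'); split=> //.
split=> [[//|t]|[|t]]; first exact: wfree.
  by rewrite w0.
exact: wstep.
Qed.

Lemma reach_far (T : nat) (s r : point) :
  reach T s r -> l1 s r <= 4 * T%:Z + 4.
Proof.
move=> [w [wrun <- near]]; have [wfree wstep] := wrun.
have lip p q : free p -> free q -> l1 p q <= 4 -> `|l1 s p - l1 s q| <= 4.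
  by move=> _ _; rewrite /l1; lia.
by have := run_potential lip wrun; lia.
Qed.

(** The values of [guide] are shifted by l to be natural numbers, and capped at
twice the bound on the coordinates of the barrier. The cap gives cells that are
out of reach no influence, and a known value when the robber is far away. *)
Definition guide_cap : nat := `|(2 * l)%R|%N.

Definition guide_spec (c : C) (r : point) (a : nat) : Prop :=
  (guide_cap <= a)%N \/
  exists z T, [/\ B c (diagonal z), reach T (diagonal z) r
                & coord z + l + T%:Z <= a%:Z].

Lemma guide_ex (c : C) (r : point) : exists a, `[< guide_spec c r a >].
Proof. by exists guide_cap; apply/asboolP; left. Qed.

Definition guide (c : C) (r : point) : nat := ex_minn (guide_ex c r).

Lemma guide_min (c : C) (r : point) (a : nat) :
  guide_spec c r a -> (guide c r <= a)%N.
Proof.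
by move=> ra; rewrite /guide; case: ex_minnP => b _; apply; apply/asboolP.
Qed.

Lemma guideP (c : C) (r : point) : guide_spec c r (guide c r).
Proof. by rewrite /guide; case: ex_minnP => b /asboolP. Qed.

(** Any candidate value for r gives, after one more move, a candidate for the
neighbour r' of r. *)
Lemma guide_le (c : C) (r r' : point) :
  free r' -> l1 r' r <= 4 -> (guide c r' <= (guide c r).+1)%N.
Proof.
move=> fr' near; apply: guide_min.
case: (guideP c r) => [cap|[z [T [Bz rz le]]]]; first by left; lia.
by right; exists z, T.+1; split=> //; [exact: reachS rz | lia].
Qed.

Hypotheses (l8 : 8 <= l) (guardB : guarded_segment l B).
Hypothesis coord_lip : forall z z',
  2 * `|coord z - coord z'| <= l1 (diagonal z) (diagonal z').
Hypothesis coord0 : coord (0, 0) = 0.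

(** Other cells of the same colour cannot give a smaller value: that is exactly
the pace condition. *)
Lemma guide_hit (c : C) (r : point) (z : int * int) :
  B c (diagonal z) -> free r -> l1 (diagonal z) r <= 4 ->
  (guide c r)%:Z = coord z + l.
Proof.
move=> Bz fr near.
have zl : `|coord z| <= l.
  have [/= h1 h2] := guarded_extent guardB Bz.
  by have := coord_lip z (0, 0); rewrite coord0 /l1 /=; lia.
have runr : run free 0 (fun=> r) by split.
have le : (guide c r)%:Z <= coord z + l.
  suff : (guide c r <= `|(coord z + l)%R|)%N by lia.
  apply: guide_min; right; exists z, 0%N; split=> //; last by lia.
  by exists (fun=> r).
case: (guideP c r) => [cap|[z' [T [Bz' [w [wrun w0 wT]] le']]]].
  by move: cap; rewrite /guide_cap; lia.
have := guarded_pace guardB Bz Bz' wrun.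
rewrite w0 => /(_ near wT); have := coord_lip z z'; lia.
Qed.

Lemma guide_far (c : C) (r : point) :
  r.1 + r.2 <= - 12 * l -> guide c r = guide_cap.
Proof.
move=> far; apply/eqP; rewrite eqn_leq guide_min /=; last by left.
case: (guideP c r) => [//|[z [T [Bz /reach_far near le]]]].
have [/= h1 h2] := guarded_extent guardB Bz.
have zl : `|coord z| <= l.
  by have := coord_lip z (0, 0); rewrite coord0 /l1 /=; lia.
by move: near; rewrite /guide_cap /l1 /=; lia.
Qed.

End Guide.

(** The row of the strip nearest to the height y: barriers extend beyond the
strip, and projecting to the strip does not increase distances. *)
Definition row (n : nat) (y : int) : 'I_n.+1 :=
  inord (if y < 0 then 0%N else minn n `|y|).

Lemma rowE (n : nat) (y : int) :
  (row n y : nat) = if y < 0 then 0%N else minn n `|y|.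
Proof. by rewrite inordK //; case: ifPn => //; lia. Qed.

Lemma row_lip (n : nat) (y y' : int) : `|y - y'| <= 1 ->
  `|(row n y : nat)%:Z - (row n y' : nat)%:Z| <= 1.
Proof. by rewrite !rowE; do ![case: ifPn => ?]; lia. Qed.

(** The strategy sends the cop of each colour to the place given by [guide] for
its two coordinates. If the robber ever stepped on a cell of the barrier, the
cop of its colour would already be there. So he stays on the left of the axis of
the barrier, since 4 n <= l makes this axis cross the whole strip. The initial
position of the cops must not depend on that of the robber; the extra cop, who
never moves, stands so far to the left that the robber starts in the region
where [guide] is constant. *)
Lemma cops_win_guarded (n : nat) (l : int) (C : finType)
    (B : C -> point -> Prop) :
  (0 < n)%N -> 8 <= l -> 4 * n%:Z <= l -> guarded_segment l B ->
  cops_win n #|C|.+1.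
Proof.
case: n => // n _ l8 ln guardB.
pose free (r : point) := forall c, ~ B c r.
have fst_lip z z' : 2 * `|z.1 - z'.1| <= l1 (diagonal z) (diagonal z').
  by rewrite /l1 /=; lia.
have snd_lip z z' : 2 * `|z.2 - z'.2| <= l1 (diagonal z) (diagonal z').
  by rewrite /l1 /=; lia.
pose gx c r : int := (guide l B fst c r)%:Z - l.
pose gy c r : int := (guide l B snd c r)%:Z - l.
pose watch : vertex n.+1 := (- 6 * l, ord0).
pose post (r : point) (i : 'I_#|C|.+1) : vertex n.+1 :=
  if unlift ord0 i is Some j
  then (gx (enum_val j) r, row n (gy (enum_val j) r)) else watch.
pose c0 (i : 'I_#|C|.+1) : vertex n.+1 :=
  if unlift ord0 i is Some j then (l, row n l) else watch.
exists c0 => X adm.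
(* Outside the plays considered below, a post may be out of reach, and the cop
   then stays where he is. *)
pose sigma (h : seq (state #|C|.+1 n.+1)) : config #|C|.+1 n.+1 :=
  let s := last (c0, watch) h in fun i =>
  if (dist (s.1 i) (post (spot s.2) i) <= 1)%N then post (spot s.2) i
  else s.1 i.
exists sigma.
  move=> h s i; rewrite /sigma last_rcons; case: ifPn => // _.
  by rewrite /dist !subrr.
move=> play [p0 x0 y0] fol leg [passes uncaught].
pose r t := spot (play t).2.
have step t : l1 (r t) (r t.+1) <= 4 by rewrite l1_spot; have := leg t; lia.
have moved t i : (dist ((play t).1 i) (post (r t) i) <= 1)%N ->
    (play t.+1).1 i = post (r t) i.
  by rewrite fol mkseqS /sigma last_rcons => ->.
have r0 : (r 0%N).1 + (r 0%N).2 <= - 12 * l.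
  by have := adm ord0; rewrite /c0 unlift_none /r /= x0 /watch /=; lia.
have inv t : [/\ free (r t), (r t).2 <= - 3
                 & forall i, (play t.+1).1 i = post (r t) i].
  elim: t => [|t [rfree rleft copsP]].
    split.
    - by move=> c /(guarded_extent guardB); lia.
    - have := r0; rewrite /r /=.
      have := ltn_ord (play 0%N).2.2; lia.
    - move=> i; apply: moved; rewrite p0 /c0 /post.
      case: unliftP => [j _|_]; last by rewrite /dist !subrr.
      rewrite /gx /gy !(guide_far l8 guardB) // /guide_cap /dist /=.
      have -> : `|(2 * l)%R|%N%:Z - l = l by lia.
      by lia.
  have near := step t.
  have rfree' : free (r t.+1).
    move=> c Bc; apply: uncaught; exists t.+1, (lift ord0 (enum_rank c)); left.
    rewrite copsP /post liftK enum_rankK.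
    have near' : l1 (r t.+1) (r t) <= 4 by move: near; rewrite /l1; lia.
    rewrite /gx /gy (guide_hit l8 guardB fst_lip erefl Bc rfree near') //.
    rewrite (guide_hit l8 guardB snd_lip erefl Bc rfree near') //= !addrK.
    case: (play t.+1).2 => x y /=; congr (_, _); apply: val_inj => /=.
    by rewrite rowE /=; have := ltn_ord y; lia.
  split=> //.
    (* A move from v <= -3 leads at most to v = 1, which is still
       inside the wall. *)
    have [//|cross] := lerP (r t.+1).2 (- 3).
    have [||c Bc] := @guarded_axis _ _ _ guardB (r t.+1).
    - have := ltn_ord (play t.+1).2.2; move: cross near rleft.
      by rewrite /r /l1 /=; lia.
    - by move: cross near rleft; rewrite /l1; lia.
    - by have := rfree' _ Bc.
  move=> i; apply: moved; rewrite copsP /post.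
  case: unliftP => [j _|_]; last by rewrite /dist !subrr.
  have near' : l1 (r t.+1) (r t) <= 4 by move: near; rewrite /l1; lia.
  have gx1 : `|gx (enum_val j) (r t) - gx (enum_val j) (r t.+1)| <= 1.
    have := guide_le l fst (enum_val j) rfree' near'.
    have := guide_le l fst (enum_val j) rfree near.
    by rewrite /gx; lia.
  have gy1 : `|gy (enum_val j) (r t) - gy (enum_val j) (r t.+1)| <= 1.
    have := guide_le l snd (enum_val j) rfree' near'.
    have := guide_le l snd (enum_val j) rfree near.
    by rewrite /gy; lia.
  by rewrite /dist geq_max /= -!lez_nat !abszE gx1 row_lip.
have [t] := passes n.+1 isT.
have [_ left _] := inv t; have := ltn_ord (play t).2.2.
by move: left; rewrite /r /=; lia.
Qed.

Lemma rugby_number_le (n m : nat) : cops_win n m -> (rugby_number n <= m)%N.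
Proof.
move=> win; rewrite /rugby_number.
by case: ex_minnP => r _; apply; apply/asboolP.
Qed.

(** * Counting the cops *)

Lemma leq_expn_gain (a b s e : nat) : (0 < e)%N ->
  (2 * a ^ s <= b ^ s)%N -> (b <= 2 ^ e)%N ->
  (b * a ^ (s * e) <= b ^ (s * e))%N.
Proof.
move=> e0 gain small; rewrite !expnM.
apply: leq_trans (_ : (2 * a ^ s) ^ e <= _)%N; last by rewrite leq_exp2r.
by rewrite expnMn leq_mul2r small orbT.
Qed.

Lemma le_powR_ratio (R : realType) (a b p : nat) : (0 < b)%N ->
  (b * a ^ p.+1 <= b ^ p.+1)%N ->
  a%:R <= b%:R `^ (p%:R / p.+1%:R) :> R.
Proof.
move=> b0; rewrite [in leqRHS]expnS leq_pmul2l // => le_ab.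
rewrite -(@ler_pXn2r _ p.+1) ?nnegrE ?powR_ge0 ?ler0n //.
rewrite -(powR_mulrn _ (powR_ge0 _ _)) -powRrM divfK ?pnatr_eq0 //.
by rewrite powR_mulrn ?ler0n // -!natrX ler_nat.
Qed.

(** In 1000 steps the ratio 201 / 191 grows beyond 201, since 20 of them double
it. *)
Lemma le_powR_191 (R : realType) :
  191%:R <= 201%:R `^ (999%:R / 1000%:R) :> R.
Proof.
have gain : (2 * 191 ^ 20 <= 201 ^ 20)%N by lia.
have small : (201 <= 2 ^ 50)%N by lia.
exact: (@le_powR_ratio R 191 201 999 isT
          (@leq_expn_gain 191 201 20 50 isT gain small)).
Qed.

Lemma rugby_number_level (n k : nat) :
  (0 < n < 201 ^ k.+1)%N -> (rugby_number n <= (81 * 191 ^ k.+1).+1)%N.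
Proof.
move=> /andP[n0 nk].
have [C [B [<- guardB]]] := guarded_segment_exists k.+1.
apply/rugby_number_le/(cops_win_guarded n0 _ _ guardB).
  by rewrite ler_peMr // exprn_ege1.
have : n%:Z <= 201 ^+ k.+1 by rewrite -natz -natrX ler_nat ltnW.
by move: (201 ^+ k.+1) => N; lia.
Qed.

Unset Implicit Arguments.

Theorem theorem3p2 (R : realType) :
  exists (C0 : R) (n0 : nat), 0 < C0 /\
    forall n : nat, (0 < n)%N -> (n0 <= n)%N ->
      (rugby_number n)%:R <= C0 * n%:R `^ (999%:R / 1000%:R).
Proof.
exists (82 * 191)%:R, 1%N; split=> [|n n0 _]; first by rewrite ltr0n.
set beta := 999%:R / 1000%:R.
have beta0 : 0 <= beta :> R by rewrite divr_ge0.
pose k := trunc_log 201 n.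
have nk := trunc_log_bounds (isT : 1 < 201)%N n0.
rewrite -/k in nk.
have [kn nk1] := andP nk.
have le_r : (rugby_number n <= 82 * 191 * 191 ^ k)%N.
  apply: leq_trans (rugby_number_level (k := k) _) _; first by rewrite n0.
  by have := expn_gt0 191 k; rewrite expnS; move: (191 ^ k)%N => N; lia.
apply: le_trans (_ : (82 * 191 * 191 ^ k)%:R <= _); first by rewrite ler_nat.
rewrite natrM ler_wpM2l ?ler0n // natrX.
apply: le_trans (_ : (201%:R `^ beta) ^+ k <= _).
  by apply: lerXn2r; rewrite ?nnegrE ?powR_ge0 ?ler0n ?le_powR_191.
rewrite -powR_mulrn ?powR_ge0 // powRAC powR_mulrn ?ler0n // -natrX.
by apply: ge0_ler_powR; rewrite ?nnegrE ?ler0n ?ler_nat.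
Qed.
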